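(* For every $m,n,r,s\in \mathbb{N}$ we have $$N(m,n,r,s)= \sum \varphi(x_3)\, \varphi(y_3)\, \varphi(z_3)\, \varphi(t_3)\, F(u,v),$$ where the sum is over all $$(x_1,x_2,x_3,x_4,x_5,y_1,y_2,y_3,y_4,y_5,z_1,z_2,z_3,z_4,z_5,t_1,t_2,t_3,t_4,t_5)\in\mathbb{N}^{20}$$ satisfying the following $10$ conditions: (1) $x_1x_2x_3=m$, (2) $x_3x_4x_5=n$, (3) $y_1y_2y_3=\gcd(x_1,x_4)$, (4) $y_3y_4y_5=x_3\operatorname{lcm}(x_1,x_4)$, (5) $z_1z_2z_3=r$, (6) $z_3z_4z_5=s$, (7) $t_1t_2t_3=\gcd(z_1,z_4)$, (8) $t_3t_4t_5=z_3\operatorname{lcm}(z_1,z_4)$, (9) $\gcd(y_2,y_5)=\gcd(t_2,t_5)=:u$, (10) $y_3\operatorname{lcm}(y_2,y_5)= t_3\operatorname{lcm}(t_2,t_5)=:v$.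
   Context: $\mathbb{N}=\{1,2,\ldots\}$ and $\mathbb{Z}_n$ is the additive group of residue classes modulo $n$. $N(m,n,r,s)$ denotes the total number of subgroups of the group $\mathbb{Z}_m\times\mathbb{Z}_n\times\mathbb{Z}_r\times\mathbb{Z}_s$. $\varphi$ is Euler's totient function. $F(u,v)$ denotes the number of automorphisms of the group $\mathbb{Z}_u\times\mathbb{Z}_v$. *)

(* Defs.v *)
From HB Require Import structures.
From mathcomp Require Import all_boot all_order all_algebra all_fingroup.
From mathcomp Require Import mathcomp_extra boolp classical_sets functions cardinality fsbigop.

Set Implicit Arguments.
Unset Strict Implicit.
Unset Printing Implicit Defensive.

(* The additive group of residue classes modulo n, for n > 0. The type 'Z_n is
   not suitable, since 'Z_1 has two elements; 'I_n.-1.+1 has exactly n elements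
   when n > 0, and its finGroupType structure is addition modulo n. *)
Notation "''Zmod_' n" := 'I_(n.-1.+1)
  (at level 8, n at level 2, format "''Zmod_' n") : type_scope.

Definition num_subgroups (m n r s : nat) : nat :=
  #|subgroups [set: ('Zmod_m * 'Zmod_n * 'Zmod_r * 'Zmod_s)%type]|.

Definition num_automorphisms (u v : nat) : nat :=
  #|Aut [set: ('Zmod_u * 'Zmod_v)%type]|.

Notation nat5 := (nat * nat * nat * nat * nat)%type.

Definition positive5 (a : nat5) : Prop :=
  let: (a1, a2, a3, a4, a5) := a in
  [/\ 0 < a1, 0 < a2, 0 < a3, 0 < a4 & 0 < a5].

Definition index_set (m n r s : nat) : set (nat5 * nat5 * nat5 * nat5) :=
  [set w | let: (x, y, z, t) := w in
    [/\ positive5 x, positive5 y, positive5 z & positive5 t] /\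
    let: (x1, x2, x3, x4, x5) := x in
    let: (y1, y2, y3, y4, y5) := y in
    let: (z1, z2, z3, z4, z5) := z in
    let: (t1, t2, t3, t4, t5) := t in
    [/\ x1 * x2 * x3 = m,
        x3 * x4 * x5 = n,
        y1 * y2 * y3 = gcdn x1 x4 &
        y3 * y4 * y5 = x3 * lcmn x1 x4] /\
    [/\ z1 * z2 * z3 = r,
        z3 * z4 * z5 = s,
        t1 * t2 * t3 = gcdn z1 z4 &
        t3 * t4 * t5 = z3 * lcmn z1 z4] /\
    gcdn y2 y5 = gcdn t2 t5 /\
    y3 * lcmn y2 y5 = t3 * lcmn t2 t5]%classic.

Definition summand (w : nat5 * nat5 * nat5 * nat5) : nat :=
  let: (x, y, z, t) := w in
  let: (x1, x2, x3, x4, x5) := x in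
  let: (y1, y2, y3, y4, y5) := y in
  let: (z1, z2, z3, z4, z5) := z in
  let: (t1, t2, t3, t4, t5) := t in
  let u := gcdn y2 y5 in
  let v := y3 * lcmn y2 y5 in
  totient x3 * totient y3 * totient z3 * totient t3 * num_automorphisms u v.

Definition box5 (B : nat) : set nat5 :=
  (`I_B.+1 `*` `I_B.+1 `*` `I_B.+1 `*` `I_B.+1 `*` `I_B.+1)%classic.

Lemma box5_sub (B a1 a2 a3 a4 a5 p q : nat) :
  positive5 (a1, a2, a3, a4, a5) ->
  a1 * a2 * a3 = p -> a3 * a4 * a5 = q -> p <= B -> q <= B ->
  box5 B (a1, a2, a3, a4, a5).
Proof.
move=> [h1 h2 h3 h4 h5] <- <- pB qB.
have p0 : 0 < a1 * a2 * a3 by rewrite !muln_gt0 h1 h2 h3.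
have q0 : 0 < a3 * a4 * a5 by rewrite !muln_gt0 h3 h4 h5.
have le_p d : d %| a1 * a2 * a3 -> d < B.+1.
  by move=> dp; rewrite ltnS (leq_trans (dvdn_leq p0 dp)).
have le_q d : d %| a3 * a4 * a5 -> d < B.+1.
  by move=> dq; rewrite ltnS (leq_trans (dvdn_leq q0 dq)).
do !split; rewrite /=.
- by apply: le_p; rewrite -mulnA dvdn_mulr.
- by apply: le_p; rewrite mulnAC dvdn_mull.
- by apply: le_p; rewrite dvdn_mull.
- by apply: le_q; rewrite mulnAC dvdn_mull.
- by apply: le_q; rewrite dvdn_mull.
Qed.

Lemma box5_chain (m n : nat) (x1 x2 x3 x4 x5 y1 y2 y3 y4 y5 : nat) :
  positive5 (x1, x2, x3, x4, x5) -> positive5 (y1, y2, y3, y4, y5) ->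
  x1 * x2 * x3 = m -> x3 * x4 * x5 = n ->
  y1 * y2 * y3 = gcdn x1 x4 -> y3 * y4 * y5 = x3 * lcmn x1 x4 ->
  box5 (m * n) (x1, x2, x3, x4, x5) /\ box5 (m * n) (y1, y2, y3, y4, y5).
Proof.
move=> xP yP em en eg el; have [h1 h2 h3 h4 h5] := xP.
have m0 : 0 < m by rewrite -em !muln_gt0 h1 h2 h3.
have n0 : 0 < n by rewrite -en !muln_gt0 h3 h4 h5.
have le_mn d : d %| m * n -> d <= m * n.
  by apply: dvdn_leq; rewrite muln_gt0 m0.
split; first by apply: (box5_sub xP em en); apply: le_mn; [exact: dvdn_mulr | exact: dvdn_mull].
apply: (box5_sub yP eg el); apply: le_mn.
  by rewrite (dvdn_trans (dvdn_gcdl _ _))// dvdn_mulr// -em -mulnA dvdn_mulr.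
apply: (@dvdn_trans (x3 * (x1 * x4))).
  by rewrite dvdn_pmul2l// dvdn_lcm dvdn_mulr// dvdn_mull.
rewrite mulnCA; apply: dvdn_mul; first by rewrite -em -mulnA dvdn_mulr.
by rewrite -en dvdn_mulr.
Qed.

(* Over an infinite index set the operator \big[_/_]_(_ \in _) may be the
   neutral element by convention; this does not occur here. *)
Lemma finite_index_set (m n r s : nat) : finite_set (index_set m n r s).
Proof.
have fB B : finite_set (box5 B).
  by rewrite /box5; repeat (apply: finite_setX; last exact: finite_II); exact: finite_II.
apply: (@sub_finite_set _ _
  (box5 (m * n) `*` box5 (m * n) `*` box5 (r * s) `*` box5 (r * s))%classic).
  move=> [[[x y] z] t] [[]].
  move: x => [[[[x1 x2] x3] x4] x5]; move: y => [[[[y1 y2] y3] y4] y5].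
  move: z => [[[[z1 z2] z3] z4] z5]; move: t => [[[[t1 t2] t3] t4] t5].
  move=> px py pz pt [[e1 e2 e3 e4] [[e5 e6 e7 e8] _]].
  have [bx by_] := box5_chain px py e1 e2 e3 e4.
  have [bz bt] := box5_chain pz pt e5 e6 e7 e8.
  by [].
by repeat (apply: finite_setX; last exact: fB); exact: fB.
Qed.

(* Main.v *)
(* By Goursat's lemma a subgroup of G x H is the same thing as a quadruple of
   subgroups B <| A <= G, D <| C <= H together with an isomorphism A/B -> C/D.
   For cyclic G and H of orders a and b the quadruple amounts to numbers with
   x1 x2 x3 = a and x3 x4 x5 = b, where x1 = |B|, x2 = |G : A|, x3 = |A : B|,
   x4 = |D|, x5 = |H : C|, and there are phi(x3) isomorphisms. An abelian group
   P of rank at most 2 is determined by |P| and exponent P, being isomorphic to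
   Z_u x Z_v with v = exponent P and u = |P| / v; for a subgroup L of G x H
   with indices x one finds u = gcd(x1, x4), v = x3 lcm(x1, x4), and for
   (G x H) / L one finds u = gcd(x2, x5), v = x3 lcm(x2, x5).
   Applying Goursat's lemma to (Z_m x Z_n) x (Z_r x Z_s), and then the cyclic
   case to both factors and again to their subgroups A and C, gives the sum. *)
Require Import Defs.
From HB Require Import structures.
From mathcomp Require Import all_boot all_order all_algebra all_fingroup.
From mathcomp Require Import mathcomp_extra boolp classical_sets functions cardinality fsbigop.
(* Imported last: mathcomp.classical shadows the finset lemmas, and the group
   division of monoid.v shadows the quotient notation. *)
From mathcomp Require Import fintype finset fingroup quotient cyclic abelian.

Set Implicit Arguments.
Unset Strict Implicit.
Unset Printing Implicit Defensive.

(** * Goursat's lemma: subgroups of a direct product *)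

Section Goursat.
Variables gT rT : finGroupType.
Local Open Scope group_scope.

Definition goursat_data (K : {group gT * rT}) :
    {group gT} * {group gT} * {group rT} * {group rT} :=
  ([group of [morphism of @fst gT rT] @* K],
   [group of [morphism of @pairg1 gT rT] @*^-1 K],
   [group of [morphism of @snd gT rT] @* K],
   [group of [morphism of @pair1g gT rT] @*^-1 K]).

(** Membership form of [goursat_data], so that arguments can run on the elements of [K]. *)
Definition goursat_spec (K : {group gT * rT}) (A B : {group gT})
    (C D : {group rT}) : Prop :=
  [/\ forall a, (a \in A) = [exists c, (a, c) \in K],
      forall a, (a \in B) = ((a, 1) \in K),
      forall c, (c \in C) = [exists a, (a, c) \in K] &
      forall c, (c \in D) = ((1, c) \in K)].

Lemma goursat_dataP K A B C D :
  goursat_data K = (A, B, C, D) <-> goursat_spec K A B C D.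
Proof.
have E1 a : (a \in [morphism of @fst gT rT] @* K) = [exists c, (a, c) \in K].
  rewrite morphimEsub ?subsetT //; apply/imsetP/existsP => [[[a' c] Kp ->]|[c Kp]].
    by exists c.
  by exists (a, c).
have E3 c : (c \in [morphism of @snd gT rT] @* K) = [exists a, (a, c) \in K].
  rewrite morphimEsub ?subsetT //; apply/imsetP/existsP => [[[a c'] Kp ->]|[a Kp]].
    by exists a.
  by exists (a, c).
have E2 a : (a \in [morphism of @pairg1 gT rT] @*^-1 K) = ((a, 1) \in K).
  by rewrite !inE.
have E4 c : (c \in [morphism of @pair1g gT rT] @*^-1 K) = ((1, c) \in K).
  by rewrite !inE.
split; first by case=> <- <- <- <-; split.
case=> hA hB hC hD; congr (_, _, _, _); apply: val_inj; apply/setP => x /=.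
- by rewrite hA; exact: E1.
- by rewrite hB; exact: E2.
- by rewrite hC; exact: E3.
- by rewrite hD; exact: E4.
Qed.

(** Conjugating (b, 1) by a pair (a, c) of [K] stays in [K] and changes only the first entry, to a
    conjugate of b by a; the other factor is symmetric. *)
Lemma goursat_normal K A B C D :
  goursat_spec K A B C D -> B <| A /\ D <| C.
Proof.
case=> hA hB hC hD; split; apply/normalP; split.
- by apply/subsetP => b; rewrite hB hA => Kb; apply/existsP; exists 1.
- move=> a; rewrite hA => /existsP[c Kac]; apply/setP => b.
  rewrite mem_conjg !hB /conjg invgK -[X in (_, X)](conj1g c^-1) /conjg invgK.
  rewrite -[(_, _)]/((a, c) * ((b, 1) * (a, c)^-1)).
  by rewrite groupMl // groupMr // groupV.
- by apply/subsetP => d; rewrite hD hC => Kd; apply/existsP; exists 1.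
- move=> c; rewrite hC => /existsP[a Kac]; apply/setP => d.
  rewrite mem_conjg !hD /conjg invgK -[X in (X, _)](conj1g a^-1) /conjg invgK.
  rewrite -[(_, _)]/((a, c) * ((1, d) * (a, c)^-1)).
  by rewrite groupMl // groupMr // groupV.
Qed.

(** The quotient of two pairs of [K] splits as (a a'^-1, 1) (1, c c'^-1), so either factor lies in
    [K] exactly when the other does. One direction makes the Goursat map well defined, the other
    makes it injective. *)
Lemma goursat_coset_eq K A B C D : goursat_spec K A B C D ->
  forall p q, p \in K -> q \in K ->
  (coset B p.1 == coset B q.1) = (coset D p.2 == coset D q.2).
Proof.
move=> sK [a c] [a' c'] Kp Kq; have [hA hB hC hD] := sK.
have [/andP[_ nBA] /andP[_ nDC]] := goursat_normal sK.
have Na x y : (x, y) \in K -> x \in 'N(B).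
  by move=> Kxy; apply: (subsetP nBA); rewrite hA; apply/existsP; exists y.
have Nc x y : (x, y) \in K -> y \in 'N(D).
  by move=> Kxy; apply: (subsetP nDC); rewrite hC; apply/existsP; exists x.
have E1 : (coset B a == coset B a') = ((a * a'^-1, 1) \in K).
  by rewrite -hB -mem_rcoset (sameP eqP (rcoset_kercosetP (Na _ _ Kp) (Na _ _ Kq))).
have E2 : (coset D c == coset D c') = ((1, c * c'^-1) \in K).
  by rewrite -hD -mem_rcoset (sameP eqP (rcoset_kercosetP (Nc _ _ Kp) (Nc _ _ Kq))).
have P : (a * a'^-1, 1) * (1, c * c'^-1) \in K.
  rewrite -[_ * _]/(a * a'^-1 * 1, 1 * (c * c'^-1)) mulg1 mul1g.
  by rewrite -[(_, _)]/((a, c) * (a', c')^-1) groupM ?groupV.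
rewrite /= E1 E2; apply/idP/idP => h; first by rewrite (groupMl _ h) in P.
by rewrite (groupMr _ h) in P.
Qed.

Lemma goursat_isom K A B C D : goursat_spec K A B C D ->
  exists f : {morphism A / B >-> coset_of D},
    [/\ 'injm f, f @* (A / B) = C / D :> {set coset_of D} &
        forall p, p \in K -> f (coset B p.1) = coset D p.2].
Proof.
move=> sK; have [hA hB hC hD] := sK; have cosetE := goursat_coset_eq sK.
have [/andP[_ nBA] /andP[_ nDC]] := goursat_normal sK.
(* [g] sends the coset of a to the coset of c for any (a, c) in [K]; the default 1 occurs only
   outside [A / B]. *)
pose g (x : coset_of B) : coset_of D :=
  if [pick p in K | coset B p.1 == x] is Some p then coset D p.2 else 1.
have gE p : p \in K -> g (coset B p.1) = coset D p.2.
  move=> Kp; rewrite /g; case: pickP => [q /andP[Kq]|/(_ p)]; last by rewrite Kp eqxx.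
  by rewrite cosetE // => /eqP.
have liftA x : x \in A / B -> exists2 p, p \in K & x = coset B p.1.
  case/morphimP => a Na; rewrite hA => /existsP[c Kp] ->.
  by exists (a, c).
have A1 p : p \in K -> p.1 \in A.
  by case: p => a c Kp; rewrite hA; apply/existsP; exists c.
have C2 p : p \in K -> p.2 \in C.
  by case: p => a c Kp; rewrite hC; apply/existsP; exists a.
have NB p : p \in K -> p.1 \in 'N(B) by move=> Kp; rewrite (subsetP nBA) ?A1.
have ND p : p \in K -> p.2 \in 'N(D) by move=> Kp; rewrite (subsetP nDC) ?C2.
have gM : {in A / B &, {morph g : x y / x * y}}.
  move=> _ _ /liftA[p Kp ->] /liftA[q Kq ->].
  by rewrite -morphM ?NB // -[_ * _]/((p * q).1) !gE ?groupM // morphM ?ND.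
exists (Morphism gM); split => //.
- apply/injmP => _ _ /liftA[p Kp ->] /liftA[q Kq ->] /=.
  by rewrite !gE // => /eqP; rewrite -cosetE // => /eqP.
- apply/setP => y; apply/morphimP/idP => [[x _ /liftA[p Kp ->] ->] /=|].
    by rewrite gE // mem_quotient // C2.
  case/morphimP => c Nc; rewrite hC => /existsP[a Kp] ->.
  have xAB : coset B a \in A / B by rewrite mem_quotient // (A1 _ Kp).
  by exists (coset B a) => //=; rewrite (gE _ Kp).
Qed.

(** The fibre product of A and C over the quotient of C by D. [h] is a bare function, so that a
    morphism composed with a permutation fits directly. *)
Definition goursat_graph (A B : {group gT}) (C D : {group rT})
    (h : coset_of B -> coset_of D) : {set gT * rT} :=
  [set p | [&& p.1 \in A, p.2 \in C & h (coset B p.1) == coset D p.2]].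

Lemma goursat_graph_group (A B : {group gT}) (C D : {group rT})
    (h : coset_of B -> coset_of D) :
  B <| A -> D <| C -> {in A / B &, {morph h : x y / x * y}} ->
  group_set (goursat_graph A C h).
Proof.
move=> /andP[_ nBA] /andP[_ nDC] hM; apply/group_setP; split.
  rewrite inE /= !group1 !morph1 /=.
  (* As [h] is a bare function, h 1 = 1 is obtained by cancelling in h 1 * h 1 = h 1. *)
  by apply/eqP/(mulgI (h 1)); rewrite mulg1 -hM ?group1 // mulg1.
move=> p q; rewrite !inE => /and3P[Ap Cp /eqP Ep] /and3P[Aq Cq /eqP Eq].
rewrite !groupM //= !morphM ?(subsetP nBA) ?(subsetP nDC) //.
by rewrite hM ?mem_quotient // Ep Eq.
Qed.

Lemma goursat_graph_spec (A B : {group gT}) (C D : {group rT})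
    (h : coset_of B -> coset_of D) (K : {group gT * rT}) :
  B <| A -> D <| C -> {in A / B &, injective h} -> h 1 = 1 ->
  h @: (A / B) = C / D :> {set coset_of D} -> K = goursat_graph A C h :> {set _} ->
  goursat_spec K A B C D.
Proof.
move=> nBA nDC hI h1 hS KE; have [sBA _] := andP nBA; have [sDC _] := andP nDC.
have [nB nD] := (normal_norm nBA, normal_norm nDC).
have KE' p : (p \in K) = [&& p.1 \in A, p.2 \in C & h (coset B p.1) == coset D p.2].
  by rewrite KE inE.
split=> x.
- apply/idP/existsP => [Ax|[c]]; last by rewrite KE' => /and3P[].
  have : h (coset B x) \in C / D by rewrite -hS imset_f ?mem_quotient.
  case/morphimP => c Nc Cc Ec; exists c.
  by rewrite KE' /= Ax Cc; apply/eqP; exact: Ec.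
- rewrite KE' /= group1 morph1 /=; apply/idP/andP => [Bx|[Ax /eqP Ex]].
    by rewrite (subsetP sBA) // coset_id // h1.
  apply: coset_idr; first exact: (subsetP nB).
  by apply: hI; rewrite ?mem_quotient ?group1 // h1.
- apply/idP/existsP => [Cx|[a]]; last by rewrite KE' => /and3P[].
  have : coset D x \in C / D by rewrite mem_quotient.
  rewrite -hS => /imsetP[_ /morphimP[a Na Aa ->] Ea]; exists a.
  by rewrite KE' /= Aa Cx; apply/eqP; rewrite -Ea.
- rewrite KE' /= group1 morph1 h1 /=; apply/idP/andP => [Dx|[Cx /eqP Ex]].
    by rewrite (subsetP sDC) // coset_id.
  apply: coset_idr; first exact: (subsetP nD).
  by rewrite -Ex.
Qed.

(** Once one isomorphism f from A/B to C/D is fixed, every isomorphism is f after a unique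
    automorphism of A/B, and the subgroups with these data are the graphs of those isomorphisms. *)
Lemma card_goursat_fiber (A B : {group gT}) (C D : {group rT}) :
  B <| A -> D <| C ->
  #|[set K | goursat_data K == (A, B, C, D)]| =
  (if A / B \isog C / D then #|Aut (A / B)| else 0%N).
Proof.
move=> nBA nDC; case: ifP => [isoQ|nisog]; last first.
  apply/eqP; rewrite cards_eq0 -subset0; apply/subsetP => K; rewrite inE.
  move=> /eqP/goursat_dataP/goursat_isom[f [fI fS _]].
  by have := introT isogP (ex_intro2 _ _ f fI fS); rewrite nisog.
have [f fI /= fS] := isogP isoQ.
(* Generating makes [G] total with values in groups; for an automorphism the graph is already a
   group and nothing is added. *)
pose G a := <<goursat_graph A C (f \o fun_of_perm a)>>%G.
have aM a : a \in Aut (A / B) -> {in A / B &, {morph f \o fun_of_perm a : x y / x * y}}.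
  move=> Aa x y xP yP /=.
  have aQ z : z \in A / B -> a z \in A / B by move=> zP; rewrite Aut_closed.
  rewrite -morphM ?aQ //; congr (f _).
  by move: Aa; rewrite inE => /andP[_ /morphicP]; apply.
have GE a : a \in Aut (A / B) -> G a = goursat_graph A C (f \o fun_of_perm a) :> {set _}.
  by move=> Aa; rewrite /G /= gen_set_id // goursat_graph_group //; exact: aM.
have GS a : a \in Aut (A / B) -> goursat_spec (G a) A B C D.
  move=> Aa; apply: goursat_graph_spec (GE _ Aa) => //.
  - move=> x y xP yP /= /(injmP fI) E; apply: (@perm_inj _ a); apply: E; rewrite Aut_closed //.
  - by apply: (mulgI ((f \o fun_of_perm a) 1)); rewrite mulg1 -(aM a Aa) ?group1 // mulg1.
  - have aS : [set a x | x in A / B] = A / B :> {set coset_of B}.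
      by rewrite -[RHS](im_autm Aa) morphimEdom.
    by rewrite -fS morphimEdom imset_comp aS.
suff -> : [set K | goursat_data K == (A, B, C, D)] = G @: Aut (A / B).
  rewrite card_in_imset // => a b Aa Ab E; apply: (eq_Aut Aa Ab) => _ /morphimP[x Nx Ax ->].
  have [hA _ _ _] := GS _ Aa.
  move: (Ax); rewrite hA => /existsP[c].
  rewrite E -[_ \in _]/(_ \in (G b : {set _})) => Kb; move: (Kb); rewrite -E.
  rewrite -[_ \in G a]/(_ \in (G a : {set _})) GE // inE /= => /and3P[_ _ /eqP Ea].
  move: Kb; rewrite GE // inE /= => /and3P[_ _ /eqP Eb].
  by apply: (injmP fI); rewrite ?Aut_closed ?mem_quotient // Ea Eb.
apply/setP => K; rewrite inE; apply/eqP/imsetP => [/goursat_dataP sK|[a Aa ->]]; last first.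
  by apply/goursat_dataP; exact: GS.
have [k [kI kS kE]] := goursat_isom sK.
have kQ x : x \in A / B -> k x \in f @* (A / B).
  by move=> xP; rewrite fS -kS mem_morphim.
(* The automorphism to recover from [K] is the inverse of f after the isomorphism [k] induced by
   [K]. *)
pose b x := invm fI (k x).
have bM : {in A / B &, {morph b : x y / x * y}}.
  by move=> x y xP yP; rewrite /b morphM // morphM ?kQ.
pose bm := Morphism bM.
have fb x : x \in A / B -> f (b x) = k x by move=> xP; rewrite /b invmK ?kQ.
have bI : 'injm bm.
  by apply/injmP => x y xP yP /= /(congr1 f); rewrite !fb // => /(injmP kI); apply.
have bS : bm @* (A / B) = A / B.
  apply/eqP; rewrite eqEcard (card_injm bI (subxx _)) leqnn andbT.
  apply/subsetP => _ /morphimP[x _ xP ->] /=.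
  by have := mem_morphim (invm_morphism fI) (kQ _ xP) (kQ _ xP); rewrite im_invm.
exists (aut bI bS); first exact: Aut_aut.
apply: val_inj; rewrite /= GE ?Aut_aut //; apply/setP => [[a c]].
have [hA _ hC _] := sK; rewrite !inE /=.
apply/idP/and3P => [Kp|[Aa Cc]].
  have Aa : a \in A by rewrite hA; apply/existsP; exists c.
  have Cc : c \in C by rewrite hC; apply/existsP; exists a.
  split => //; rewrite autE ?mem_quotient //= fb ?mem_quotient //.
  by rewrite (kE _ Kp).
rewrite autE ?mem_quotient //= fb ?mem_quotient //.
move: (Aa); rewrite hA => /existsP[c' Kp]; rewrite (kE _ Kp) /= => /eqP Ec.
have Cc' : c' \in C by rewrite hC; apply/existsP; exists a.
have nD := subsetP (normal_norm nDC).
have [_ _ _ hD] := sK.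
(* c and c' have the same coset of D, so (a, c) = (1, c c'^-1) (a, c') is a product of elements of
   [K]. *)
have : c * c'^-1 \in D by rewrite -mem_rcoset; apply/rcoset_kercosetP; rewrite ?nD.
rewrite hD => Kd; have := groupM Kd Kp.
by rewrite -[_ * _]/(1 * a, c * c'^-1 * c') mul1g mulgKV.
Qed.
End Goursat.

(** * Abelian groups of rank at most two *)

Section AbelianType.
Local Open Scope group_scope.

(* exponent G divides #|G|, so the truncated quotient is exact. *)
Definition coexponent (gT : finGroupType) (G : {set gT}) : nat :=
  #|G| %/ exponent G.

Lemma coexponent_mul_exponent (gT : finGroupType) (G : {group gT}) :
  (coexponent G * exponent G)%N = #|G|.
Proof. by rewrite divnK // exponent_dvdn. Qed.

Lemma coexponent_eq (gT : finGroupType) (G : {group gT}) u :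
  #|G| = (u * exponent G)%N -> coexponent G = u.
Proof. by move=> GE; rewrite /coexponent GE mulnK // exponent_gt0. Qed.

(** The invariant factors start with the exponent, have product [#|G|] and are as many as the rank.
    If there are at most two, the second can only be the coexponent; the filter drops trivial
    factors. *)
Lemma abelian_type_rank2 (gT : finGroupType) (G : {group gT}) :
  abelian G -> 'r(G) <= 2 ->
  abelian_type G = [seq d <- [:: exponent G; coexponent G] | 1 < d].
Proof.
move=> cGG rG; have [b dpG oG] := abelian_structure cGG.
have cardG : (\prod_(d <- abelian_type G) d)%N = #|G|.
  by rewrite -oG big_map (bigdprod_card dpG).
have hdG d s : abelian_type G = d :: s -> d = exponent G.
  (* The recursion depth of [abelian_type] is [#|G|]; being positive, it allows the unfolding that
     shows the head. *)
  rewrite /abelian_type genGidG -[#|G|]prednK // /=.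
  by case: ifP => // _ [].
have exp1 : abelian_type G = [::] -> exponent G = 1%N.
  move=> E; move: cardG; rewrite E big_nil => cG.
  by apply/eqP; rewrite -dvdn1 cG exponent_dvdn.
have := abelian_type_gt1 G; have := size_abelian_type cGG.
move: hdG exp1 cardG.
case: (abelian_type G) => [|d [|d' [|? ?]]] hdG exp1 cardG.
- by rewrite /coexponent exp1 // -cardG big_nil.
- move=> _ /=; rewrite andbT -(hdG _ _ erefl) => -> /=.
  by rewrite /coexponent -cardG -(hdG _ _ erefl) big_seq1 divnn; case: (0 < d).
- move=> _ /= /and3P[d1 d'1 _]; rewrite -(hdG _ _ erefl) d1.
  rewrite /coexponent -(hdG _ _ erefl) -cardG !big_cons big_nil muln1 mulKn ?d'1 //.
  exact: ltnW.
- by move=> /= E; rewrite -E in rG.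
Qed.

Lemma isog_rank2 (gT rT : finGroupType) (G : {group gT}) (H : {group rT}) :
  abelian G -> abelian H -> 'r(G) <= 2 -> 'r(H) <= 2 ->
  (G \isog H) = (coexponent G == coexponent H) && (exponent G == exponent H).
Proof.
move=> cGG cHH rG rH; apply/idP/andP => [iGH|[/eqP cE /eqP eE]].
  by rewrite /coexponent (card_isog iGH) (exponent_isog iGH).
by rewrite eq_abelian_type_isog // !abelian_type_rank2 // cE eE.
Qed.

(** Serves to compute exponents, whose multiples are described by powers of elements. *)
Lemma eq_dvdn a b : (forall n, (a %| n) = (b %| n)) -> a = b.
Proof. by move=> E; apply/eqP; rewrite eqn_dvd (E b) -(E a) !dvdnn. Qed.

Lemma exponent_quotient_dvdn (gT : finGroupType) (G L : {group gT}) n :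
  L <| G -> (exponent (G / L) %| n) = [forall x in G, x ^+ n \in L].
Proof.
move=> nLG; have nL := subsetP (normal_norm nLG).
apply/exponentP/forall_inP => [E x Gx | E _ /morphimP[x Nx Gx ->]].
  apply: coset_idr; first by rewrite groupX ?nL.
  by rewrite morphX ?nL //= E // mem_quotient.
by rewrite -morphX //= coset_id // E.
Qed.

Lemma expg_pair (gT rT : finGroupType) (p : gT * rT) n : p ^+ n = (p.1 ^+ n, p.2 ^+ n).
Proof. by elim: n => [|n IHn]; rewrite ?expg0 // !expgS IHn. Qed.

Lemma abelian_setT_pair (gT rT : finGroupType) :
  abelian [set: gT] -> abelian [set: rT] -> abelian [set: gT * rT].
Proof.
move=> /centsP cG /centsP cH; apply/centsP => -[a c] _ [a' c'] _.
by congr (_, _); [apply: cG | apply: cH]; rewrite inE.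
Qed.

(** If x and y generate the factors, (x, 1) and (1, y) generate the product; the rank of an abelian
    group is its least number of generators. *)
Lemma rank_setT_pair (gT rT : finGroupType) :
  cyclic [set: gT] -> cyclic [set: rT] -> 'r([set: gT * rT]) <= 2.
Proof.
move=> cG cH; have cGH := abelian_setT_pair (cyclic_abelian cG) (cyclic_abelian cH).
case/cyclicP: cG => x xG; case/cyclicP: cH => y yH.
rewrite -grank_abelian //.
rewrite [X in 'm(X)](_ : _ = <<[set (x, 1); (1, y)]>>).
  by rewrite (leq_trans (grank_min _)) // cards2; case: eqP.
apply/esym/setP => -[a c]; rewrite [RHS]inE.
have /cycleP[i ->] : a \in <[x]> by rewrite -xG inE.
have /cycleP[j ->] : c \in <[y]> by rewrite -yH inE.
have -> : (x ^+ i, y ^+ j) = (x, 1) ^+ i * (1, y) ^+ j :> gT * rT.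
  by rewrite !expg_pair !expg1n /= -[RHS]/(_ * _, _ * _) /= mulg1 mul1g.
by rewrite groupM // groupX // mem_gen // !inE eqxx ?orbT.
Qed.

(** * Order and exponent of a subgroup of a product, exponent of its quotient *)

Section Pair.
Variables (gT rT : finGroupType) (K : {group gT * rT}).
Variables (A B : {group gT}) (C D : {group rT}).
Hypothesis sK : goursat_spec K A B C D.

Lemma goursat_exponent : exponent K = lcmn (exponent A) (exponent C).
Proof.
have [hA hB hC hD] := sK; apply: eq_dvdn => n; rewrite dvdn_lcm.
apply/exponentP/andP => [E|[/exponentP EA /exponentP EC] [a c] Kp].
  split; apply/exponentP => x.
    by rewrite hA => /existsP[c /E]; rewrite expg_pair => -[].
  by rewrite hC => /existsP[a /E]; rewrite expg_pair => -[].
rewrite expg_pair /= EA ?EC // ?hA ?hC; apply/existsP; first by exists a.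
by exists c.
Qed.

(** The second projection maps [K] onto C, with kernel a copy of B. *)
Lemma goursat_card : #|K| = (#|B| * #|C|)%N.
Proof.
have [hA hB hC hD] := sK.
have /goursat_dataP := sK; case=> _ _ <- _ /=.
have sKT : K \subset [set: gT * rT] by rewrite subsetT.
rewrite card_morphim setTI -(Lagrange (subsetIl K ('ker [morphism of @snd gT rT]))).
congr (_ * _)%N.
- rewrite -(card_injm (injm_pairg1 gT rT) (subsetT B)); apply: eq_card => -[a c].
rewrite morphim_pairg1 !inE /= hB; apply/andP/andP => [[Kp /eqP c1]|[Kp /eqP->]].
  by rewrite -c1.
- by rewrite eqxx.
- exact: indexgI.
Qed.

(** All (a^n, c^n) lie in [K] iff all (a^n, 1) and all (1, c^n) do, which is a condition on B and on
    D separately. *)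
Lemma goursat_exponent_quotient : abelian [set: gT] -> abelian [set: rT] ->
  exponent ([set: gT * rT] / K) = lcmn (exponent ([set: gT] / B)) (exponent ([set: rT] / D)).
Proof.
move=> cG cH; have [hA hB hC hD] := sK; apply: eq_dvdn => n.
have nrm (T : finGroupType) (L : {group T}) : abelian [set: T] -> L <| [set: T].
  by move=> cT; rewrite -sub_abelian_normal ?subsetT.
have cGH := abelian_setT_pair cG cH.
rewrite dvdn_lcm !exponent_quotient_dvdn ?nrm //.
apply/forall_inP/andP => [E|[/forall_inP EB /forall_inP ED] [a c] _].
  split; apply/forall_inP => x _.
    by have := E (x, 1) (in_setT _); rewrite expg_pair expg1n hB.
  by have := E (1, x) (in_setT _); rewrite expg_pair expg1n hD.
have := EB a (in_setT _); have := ED c (in_setT _); rewrite hB hD expg_pair => Kc Ka.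
by have := groupM Ka Kc; rewrite -[_ * _]/(_ * _, _ * _) mulg1 mul1g.
Qed.

Lemma goursat_index : #|A : B| = #|C : D|.
Proof.
have [f [fI fS _]] := goursat_isom sK; have [nBA nDC] := goursat_normal sK.
rewrite -!card_quotient ?normal_norm // -(card_injm fI) //.
by rewrite fS.
Qed.

End Pair.
End AbelianType.

(** * Pairs of factorizations linked by a common factor *)

Definition factorizations (a b : nat) : seq nat5 :=
  (* Each entry divides a or b, hence is at most a b when both are positive. *)
  let I := iota 0 (a * b).+1 in
  [seq x <- allpairs pair (allpairs pair (allpairs pair (allpairs pair I I) I) I) I |
    let: (x1, x2, x3, x4, x5) := x in
    (x1 * x2 * x3 == a) && (x3 * x4 * x5 == b)].

Lemma factorizations_uniq a b : uniq (factorizations a b).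
Proof.
apply: filter_uniq; do !apply: allpairs_uniq; rewrite ?iota_uniq //;
  by move=> [? ?] [? ?] _ _ /= [-> ->].
Qed.

Lemma mem_factorizations a b x1 x2 x3 x4 x5 : 0 < a -> 0 < b ->
  ((x1, x2, x3, x4, x5) \in factorizations a b) =
  (x1 * x2 * x3 == a) && (x3 * x4 * x5 == b).
Proof.
move=> a_gt0 b_gt0; rewrite mem_filter; apply: andb_idr => /andP[/eqP ea /eqP eb].
have le_a d : d %| a -> d < (a * b).+1.
  by move=> da; rewrite ltnS dvdn_leq ?muln_gt0 ?a_gt0 // dvdn_mulr.
have le_b d : d %| b -> d < (a * b).+1.
  by move=> db; rewrite ltnS dvdn_leq ?muln_gt0 ?a_gt0 // dvdn_mull.
do !apply: allpairs_f; rewrite mem_iota /= add0n.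
- by rewrite le_a // -ea -mulnA dvdn_mulr.
- by rewrite le_a // -ea mulnAC dvdn_mull.
- by rewrite le_a // -ea dvdn_mull.
- by rewrite le_b // -eb mulnAC dvdn_mull.
- by rewrite le_b // -eb dvdn_mull.
Qed.

(** For the indices [x] of a subgroup L, [middle] is x3; [sub_gcd] and [sub_exp] are the invariants
    of L, from x1 and x4; [quo_gcd] and [quo_exp] are those of the quotient by L, from x2 and x5. *)
Definition middle (x : nat5) : nat := x.1.1.2.
Definition sub_gcd (x : nat5) : nat := gcdn x.1.1.1.1 x.1.2.
Definition sub_exp (x : nat5) : nat := middle x * lcmn x.1.1.1.1 x.1.2.
Definition quo_gcd (x : nat5) : nat := gcdn x.1.1.1.2 x.2.
Definition quo_exp (x : nat5) : nat := middle x * lcmn x.1.1.1.2 x.2.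

(** * Subgroups of a product of two cyclic groups *)

Section CyclicPair.
Local Open Scope group_scope.

Lemma cyclic_subgroup_card (gT : finGroupType) (G : {group gT}) d :
  cyclic G -> d %| #|G| -> exists H : {group gT}, H \subset G /\ #|H| = d.
Proof.
case/cyclicP => x -> dG; exists <[x ^+ (#[x] %/ d)]>%G.
rewrite cycle_subG mem_cycle; split => //.
rewrite -[LHS]/#[_] orderXdiv; last by rewrite dvdn_div.
rewrite divnA // mulKn // order_gt0 //.
Qed.

Variables (gT rT : finGroupType).
Hypotheses (cG : cyclic [set: gT]) (cH : cyclic [set: rT]).
Variables (a b : nat) (card_gT : #|[set: gT]| = a) (card_rT : #|[set: rT]| = b).

Definition goursat_indices (L : {group gT * rT}) : nat5 :=
  let: (A, B, C, D) := goursat_data L in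
  (#|B|, #|[set: gT] : A|, #|A : B|, #|D|, #|[set: rT] : C|).

Let nG (T : finGroupType) (A B : {group T}) :
  cyclic [set: T] -> B \subset A -> B <| A.
Proof.
move=> cT sBA; rewrite -sub_abelian_normal //.
exact: abelianS (subsetT A) (cyclic_abelian cT).
Qed.

Lemma goursat_indices_factorizations L : goursat_indices L \in factorizations a b.
Proof.
rewrite /goursat_indices; case E : (goursat_data L) => [[[A B] C] D].
have /goursat_dataP sL := E; have [nBA nDC] := goursat_normal sL.
rewrite -card_gT -card_rT mem_factorizations ?cardG_gt0 // mulnAC Lagrange ?normal_sub //.
rewrite (Lagrange (subsetT A)) eqxx /=.
rewrite (goursat_index sL) (mulnC #|C : D|) Lagrange ?normal_sub //.
by rewrite (Lagrange (subsetT C)) eqxx.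
Qed.

(** A cyclic group has one subgroup of each admissible order, so [x] determines all four Goursat
    groups, and the fibre over them counts the automorphisms of a cyclic group of order x3. *)
Lemma card_goursat_indices x : x \in factorizations a b ->
  #|[set L | goursat_indices L == x]| = totient (middle x).
Proof.
have a_gt0 : 0 < a by rewrite -card_gT cardG_gt0.
have b_gt0 : 0 < b by rewrite -card_rT cardG_gt0.
move: x => [[[[x1 x2] x3] x4] x5]; rewrite mem_factorizations // => /andP[/eqP ea /eqP eb].
(* The orders are forced: x1 x3 is |B| |A : B|, and x4 x3 is |D| |C : D|. *)
have [A [_ cA]] : exists A : {group gT}, A \subset [set: gT]%G /\ #|A| = (x1 * x3)%N.
  by apply: cyclic_subgroup_card => //; rewrite card_gT -ea mulnAC dvdn_mulr.
have [C [_ cC]] : exists C : {group rT}, C \subset [set: rT]%G /\ #|C| = (x4 * x3)%N.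
  by apply: cyclic_subgroup_card => //; rewrite card_rT -eb [(x3 * _)%N]mulnC dvdn_mulr.
have cycA : cyclic A by apply: cyclicS cG; exact: subsetT.
have cycC : cyclic C by apply: cyclicS cH; exact: subsetT.
move: a_gt0 b_gt0; rewrite -ea -eb !muln_gt0.
move=> /andP[/andP[x1_gt0 x2_gt0] x3_gt0] /andP[/andP[_ x4_gt0] x5_gt0].
have [B [sBA cB]] : exists B : {group gT}, B \subset A /\ #|B| = x1.
  by apply: cyclic_subgroup_card => //; rewrite cA dvdn_mulr.
have [D [sDC cD]] : exists D : {group rT}, D \subset C /\ #|D| = x4.
  by apply: cyclic_subgroup_card => //; rewrite cC dvdn_mulr.
have iAB : #|A / B| = x3.
  by rewrite card_quotient ?normal_norm ?nG // -divgS // cA cB mulKn.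
have iCD : #|C / D| = x3.
  by rewrite card_quotient ?normal_norm ?nG // -divgS // cC cD mulKn.
rewrite [LHS](_ : _ = #|[set L | goursat_data L == (A, B, C, D)]|).
  rewrite card_goursat_fiber ?nG // isog_cyclic_card ?quotient_cyclic //.
  by rewrite iCD iAB eqxx card_Aut_cyclic ?quotient_cyclic // iAB.
apply: eq_card => L; rewrite !inE /goursat_indices.
case E : (goursat_data L) => [[[A' B'] C'] D'].
have /goursat_dataP/goursat_normal [/andP[sBA' _] /andP[sDC' _]] := E.
apply/eqP/eqP => [[eB eA eAB eD eC]|[-> -> -> ->]]; last first.
  rewrite cB cD; congr (_, _, _, _, _).
  - by rewrite -divgS ?subsetT // card_gT -ea cA mulnAC mulKn // muln_gt0 x1_gt0.
  - by rewrite -divgS // cA cB mulKn.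
  - by rewrite -divgS ?subsetT // card_rT -eb cC [(x3 * x4)%N]mulnC mulKn // muln_gt0 x4_gt0.
have eqG (T : finGroupType) (U V : {group T}) : cyclic [set: T] -> #|U| = #|V| -> U = V.
  move=> cT UV; apply: val_inj; apply/eqP.
  by rewrite (eq_subG_cyclic cT) ?subsetT // UV.
have eC' := Lagrange (subsetT C'); have eA' := Lagrange (subsetT A').
congr (_, _, _, _); apply: eqG => //.
- by rewrite -(Lagrange sBA') eB eAB cA.
- by rewrite eB.
(* The indices record |A' : B'| but not |C' : D'|, so the order of C' is recovered from its index
   x5. *)
- by apply/eqP; rewrite -(eqn_pmul2r x5_gt0) -{1}eC eC' card_rT -eb cC (mulnC x4).
- by rewrite eD.
Qed.

(** With k = |A : B|, cyclicity of A and C makes the exponent of L the lcm of k |B| and k |D|, while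
    L has order k |B| |D|; dividing leaves gcd(|B|, |D|). The quotient is treated alike, with k
    times the indices of A and C as the indices of B and D. *)
Lemma goursat_indices_type L : let x := goursat_indices L in
  [/\ coexponent L = sub_gcd x, exponent L = sub_exp x,
      coexponent ([set: gT * rT] / L) = quo_gcd x &
      exponent ([set: gT * rT] / L) = quo_exp x].
Proof.
rewrite /goursat_indices; case E : (goursat_data L) => [[[A B] C] D].
have /goursat_dataP sL := E; have [/andP[sBA _] /andP[sDC _]] := goursat_normal sL.
rewrite /sub_gcd /sub_exp /quo_gcd /quo_exp /middle /=.
have iAB := goursat_index sL.
have cycS (T : finGroupType) (U : {group T}) : cyclic [set: T] -> cyclic U.
  by apply: cyclicS; exact: subsetT.
set k := #|A : B| in iAB *; set p := #|_ : A|; set q := #|_ : C|.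
have cA : #|A| = (k * #|B|)%N by rewrite mulnC (Lagrange sBA).
have cC : #|C| = (k * #|D|)%N by rewrite mulnC iAB (Lagrange sDC).
have iB : #|[set: gT] : B| = (k * p)%N.
  by rewrite mulnC (Lagrange_index (subsetT A) sBA).
have iD : #|[set: rT] : D| = (k * q)%N.
  by rewrite mulnC iAB (Lagrange_index (subsetT C) sDC).
have eL : exponent L = (k * lcmn #|B| #|D|)%N.
  rewrite (goursat_exponent sL) (exponent_cyclic (cycS _ A cG)).
  by rewrite (exponent_cyclic (cycS _ C cH)) cA cC muln_lcmr.
have cL : #|L| = (#|B| * #|D| * k)%N.
  by rewrite (goursat_card sL) cC -mulnA [(_ * k)%N]mulnC.
have cGH : abelian [set: gT * rT] by apply: abelian_setT_pair; exact: cyclic_abelian.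
have eQ : exponent ([set: gT * rT] / L) = (k * lcmn p q)%N.
  rewrite (goursat_exponent_quotient sL) ?cyclic_abelian //.
  rewrite (exponent_cyclic (quotient_cyclic _ cG)) (exponent_cyclic (quotient_cyclic _ cH)).
  rewrite !card_quotient ?normal_norm ?nG ?subsetT //.
  by rewrite iB iD muln_lcmr.
have cQ : #|[set: gT * rT] / L| = (p * q * k)%N.
  rewrite card_quotient; last first.
    by rewrite normal_norm // -sub_abelian_normal // subsetT.
  rewrite -divgS ?subsetT // cL.
  have -> : #|[set: gT * rT]| = (#|[set: gT]| * #|[set: rT]|)%N.
    by rewrite !cardsT card_prod.
  rewrite -(Lagrange (subsetT A)) -(Lagrange (subsetT C)) -/p -/q cA cC.
  have -> : (k * #|B| * p * (k * #|D| * q) = p * q * k * (#|B| * #|D| * k))%N.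
    by rewrite [LHS](AC (3*3) ((3*6*1)*(2*5*4)))%AC.
  by rewrite mulnK // !muln_gt0 !cardG_gt0 indexg_gt0.
have gcd_lcm i j : (i * j * k = gcdn i j * (k * lcmn i j))%N.
  by rewrite mulnCA [(gcdn _ _ * _)%N]mulnC muln_lcm_gcd mulnC.
by split => //; apply: coexponent_eq; rewrite ?cL ?eL ?cQ ?eQ gcd_lcm.
Qed.

(** [f] sees the invariants of both L and its quotient because two uses follow: subgroups A counted
    by their own type, and B in A counted by the type of A/B. *)
Lemma sum_subgroups_cyclic_pair (f : nat -> nat -> nat -> nat -> nat) :
  (\sum_(L : {group gT * rT})
    f (coexponent L) (exponent L) (coexponent ([set: gT * rT] / L)) (exponent ([set: gT * rT] / L)) =
  \sum_(x <- factorizations a b)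
    totient (middle x) * f (sub_gcd x) (sub_exp x) (quo_gcd x) (quo_exp x))%N.
Proof.
pose F x := f (sub_gcd x) (sub_exp x) (quo_gcd x) (quo_exp x).
(* Each term becomes a sum over the single factorization given by the indices of L, so that the two
   sums can be exchanged. *)
transitivity (\sum_(L : {group gT * rT}) \sum_(x <- factorizations a b | x == goursat_indices L) F x)%N.
  apply: eq_bigr => L _; have [-> -> -> ->] := goursat_indices_type L.
  by rewrite -big_filter filter_pred1_uniq ?factorizations_uniq ?goursat_indices_factorizations // big_seq1.
rewrite (exchange_big_dep predT) //=; apply: eq_big_seq => x xS.
rewrite sum_nat_const -(card_goursat_indices xS); congr (_ * _)%N.
by apply: eq_card => L; rewrite !inE eq_sym.
Qed.
End CyclicPair.

(** * Transport to standard models, and products of two groups of rank at most two *)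

Section RankTwo.
Local Open Scope group_scope.

(** Image and preimage under an injective morphism are inverse bijections between the subgroups of G
    and those of its image. *)
Lemma sum_subgroups_injm (aT rT : finGroupType) (G : {group aT})
    (f : {morphism G >-> rT}) (F : {group rT} -> nat) : 'injm f ->
  (\sum_(M : {group rT} | M \subset f @* G) F M =
   \sum_(L : {group aT} | L \subset G) F [group of f @* L])%N.
Proof.
move=> fI; rewrite (reindex_onto (fun L : {group aT} => [group of f @* L])
  (fun M : {group rT} => [group of f @*^-1 M])) /=; last first.
  by move=> M sM; apply: val_inj; rewrite /= morphpreK.
apply: eq_bigl => L; apply/andP/idP => [[_ /eqP <-]|sL]; first exact: subsetIl.
by rewrite morphimS //; split=> //; apply/eqP/val_inj; rewrite /= injmK.
Qed.

Lemma coexponent_quotient_injm (aT rT : finGroupType) (G L : {group aT})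
    (f : {morphism G >-> rT}) : abelian G -> 'injm f -> L \subset G ->
  coexponent (G / L) = coexponent (f @* G / f @* L) /\
  exponent (G / L) = exponent (f @* G / f @* L).
Proof.
move=> cGG fI sLG.
have nLG : L <| G by rewrite -sub_abelian_normal.
have nfL : f @* L <| f @* G by exact: morphim_normal.
have eE : exponent (G / L) = exponent (f @* G / f @* L).
  apply: eq_dvdn => n; rewrite !exponent_quotient_dvdn //.
  apply/forall_inP/forall_inP => [E _ /morphimP[x Gx _ ->]|E x Gx].
    by rewrite -morphX // mem_morphim // ?E // groupX.
  have := E (f x) (mem_morphim f Gx Gx); rewrite -morphX //.
  by case/morphimP => y Gy Ly /(injmP fI) ->; rewrite ?groupX.
split => //; rewrite /coexponent -eE !card_quotient ?normal_norm //.
by rewrite -!divgS ?morphimS // !card_injm.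
Qed.

Lemma card_Aut_isog (gT rT : finGroupType) (G : {group gT}) (H : {group rT}) :
  G \isog H -> #|Aut G| = #|Aut H|.
Proof.
move=> iGH; have [f fI /= <-] := isogP iGH.
by rewrite (card_isog (injm_Aut fI (subxx _))).
Qed.

(** Invariant factors form a divisibility chain; the other cases are those where the filter has
    removed a factor 1. *)
Lemma coexponent_dvd_exponent (gT : finGroupType) (G : {group gT}) :
  abelian G -> 'r(G) <= 2 -> coexponent G %| exponent G.
Proof.
move=> cGG rG; have := abelian_type_dvdn_sorted G.
rewrite abelian_type_rank2 //=.
case: (ltngtP (exponent G) 1) => [| e1 | e1].
- by rewrite ltnNge exponent_gt0.
- case: (ltngtP (coexponent G) 1) => [|c1|->] //=; last by rewrite andbT.
  by rewrite ltnS leqn0 => /eqP E; have := cardG_gt0 G;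
    rewrite -(coexponent_mul_exponent G) E.
- move=> _; have /eqP G1 : G :==: 1 by rewrite trivg_exponent e1.
  by rewrite /coexponent e1 G1 cards1.
Qed.

Lemma cyclic_Zmod n : cyclic [set: 'Zmod_n].
Proof. by rewrite Zp_cycle cycle_cyclic. Qed.

Lemma card_Zmod n : 0 < n -> #|[set: 'Zmod_n]| = n.
Proof. by move=> n_gt0; rewrite cardsT card_ord prednK. Qed.

(** The coexponent u divides the exponent v, so Z_u x Z_v has exponent lcm(u, v) = v and order u v,
    as G has. *)
Lemma isog_Zmod_pair (gT : finGroupType) (G : {group gT}) :
  abelian G -> 'r(G) <= 2 ->
  G \isog [set: 'Zmod_(coexponent G) * 'Zmod_(exponent G)].
Proof.
move=> cGG rG; set u := coexponent G; set v := exponent G.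
have v_gt0 : 0 < v by exact: exponent_gt0.
have u_gt0 : 0 < u.
  by have := cardG_gt0 G; rewrite -(coexponent_mul_exponent G) muln_gt0 => /andP[].
have cZ n : abelian [set: 'Zmod_n] by apply: cyclic_abelian; exact: cyclic_Zmod.
have vE : exponent [set: 'Zmod_u * 'Zmod_v] = v.
  (* The whole product is the subgroup with trivial Goursat quotients, so its exponent is the lcm of
     those of the factors. *)
  have sT : goursat_spec [set: 'Zmod_u * 'Zmod_v]%G
      [set: 'Zmod_u]%G [set: 'Zmod_u]%G [set: 'Zmod_v]%G [set: 'Zmod_v]%G.
    by split=> x; rewrite !inE //; apply/esym/existsP; exists 1; rewrite inE.
  rewrite (goursat_exponent sT) !exponent_cyclic ?cyclic_Zmod // !card_Zmod //.
  by apply/lcmn_idPr; exact: coexponent_dvd_exponent.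
rewrite isog_rank2 ?abelian_setT_pair ?rank_setT_pair ?cyclic_Zmod //.
rewrite -/u -/v vE eqxx andbT eq_sym; apply/eqP/coexponent_eq.
by rewrite vE cardsT card_prod -!cardsT !card_Zmod.
Qed.

(** An isomorphism moves the sum to Z_u x Z_v, where the count for two cyclic factors applies. *)
Lemma sum_quotients_rank2 (gT : finGroupType) (G : {group gT})
    (f : nat -> nat -> nat) : abelian G -> 'r(G) <= 2 ->
  (\sum_(L : {group gT} | L \subset G) f (coexponent (G / L)) (exponent (G / L)) =
   \sum_(y <- factorizations (coexponent G) (exponent G))
     totient (middle y) * f (quo_gcd y) (quo_exp y))%N.
Proof.
move=> cGG rG; have [h hI /= hS] := isogP (isog_Zmod_pair cGG rG).
have v_gt0 : 0 < exponent G by exact: exponent_gt0.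
have u_gt0 : 0 < coexponent G.
  by have := cardG_gt0 G; rewrite -(coexponent_mul_exponent G) muln_gt0 => /andP[].
rewrite -(sum_subgroups_cyclic_pair (cyclic_Zmod _) (cyclic_Zmod _)
  (card_Zmod u_gt0) (card_Zmod v_gt0) (fun _ _ => f)).
transitivity (\sum_(L : {group gT} | L \subset G)
    (f (coexponent (h @* G / h @* L)) (exponent (h @* G / h @* L))))%N.
  by apply: eq_bigr => L sL; have [-> ->] := coexponent_quotient_injm cGG hI sL.
rewrite -(sum_subgroups_injm (fun M => f (coexponent (h @* G / M)) (exponent (h @* G / M))) hI).
by rewrite hS; apply: eq_bigl => L; rewrite subsetT.
Qed.

(** Subgroups are partitioned by Goursat data. A fibre is empty unless B lies in A, D lies in C and
    the quotients are isomorphic; the boolean factor is this last condition, read on the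
    invariants. *)
Lemma card_subgroups_pair (T1 T2 : finGroupType) :
  abelian [set: T1] -> 'r([set: T1]) <= 2 ->
  abelian [set: T2] -> 'r([set: T2]) <= 2 ->
  (#|{group T1 * T2}| =
   \sum_(A : {group T1}) \sum_(B : {group T1} | B \subset A)
   \sum_(C : {group T2}) \sum_(D : {group T2} | D \subset C)
     ((coexponent (A / B) == coexponent (C / D)) && (exponent (A / B) == exponent (C / D))) *
     num_automorphisms (coexponent (A / B)) (exponent (A / B)))%N.
Proof.
move=> c1 r1 c2 r2.
have norm (T : finGroupType) (U V : {group T}) : abelian [set: T] -> V \subset U -> V <| U.
  by move=> cT sVU; rewrite -sub_abelian_normal // (abelianS (subsetT U) cT).
have cS (T : finGroupType) (U : {group T}) : abelian [set: T] -> abelian U.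
  by apply: abelianS; exact: subsetT.
have rS (T : finGroupType) (U V : {group T}) : abelian [set: T] -> 'r([set: T]) <= 2 -> 'r(U / V) <= 2.
  move=> cT; apply: leq_trans; apply: leq_trans (quotient_rank_abelian _ (cS _ _ cT)) _.
  by apply: rankS; exact: subsetT.
rewrite -sum1_card (partition_big (@goursat_data T1 T2) predT) //=.
under eq_bigr => j _ do rewrite sum1dep_card.
transitivity (\sum_A \sum_B \sum_C \sum_D
  #|[set K | goursat_data K == (A : {group T1}, B : {group T1}, C : {group T2}, D : {group T2})]|)%N.
  by rewrite !pair_bigA /=; apply: eq_bigr => -[[[A B] C] D].
apply: eq_bigr => A _; rewrite [RHS]big_mkcond /=; apply: eq_bigr => B _.
case: ifP => sBA; last first.
  rewrite big1 // => C _; rewrite big1 // => D _; apply/eqP.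
  rewrite cards_eq0 -subset0; apply/subsetP => K; rewrite inE.
  by move=> /eqP/goursat_dataP/goursat_normal[/andP[]]; rewrite sBA.
apply: eq_bigr => C _; rewrite [RHS]big_mkcond /=; apply: eq_bigr => D _.
case: ifP => sDC; last first.
  apply/eqP; rewrite cards_eq0 -subset0; apply/subsetP => K; rewrite inE.
  by move=> /eqP/goursat_dataP/goursat_normal[_ /andP[]]; rewrite sDC.
have cQ1 : abelian (A / B) by exact: quotient_abelian (cS _ _ c1).
have cQ2 : abelian (C / D) by exact: quotient_abelian (cS _ _ c2).
rewrite card_goursat_fiber ?norm // (isog_rank2 cQ1 cQ2 (rS _ _ _ c1 r1) (rS _ _ _ c2 r2)).
case: ifP => _; rewrite ?mul0n // mul1n.
by rewrite (card_Aut_isog (isog_Zmod_pair cQ1 (rS _ _ _ c1 r1))).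
Qed.

(** The fourfold product is nested to the left; reassociation gives the product of two pairs to
    which Goursat's lemma is applied. *)
Lemma num_subgroupsE m n r s :
  num_subgroups m n r s = #|{group ('Zmod_m * 'Zmod_n) * ('Zmod_r * 'Zmod_s)}|.
Proof.
pose assoc (p : 'Zmod_m * 'Zmod_n * 'Zmod_r * 'Zmod_s) := (p.1.1, (p.1.2, p.2)).
have assocM : {in [set: 'Zmod_m * 'Zmod_n * 'Zmod_r * 'Zmod_s] &,
  {morph assoc : x y / x * y}} by [].
pose f := Morphism assocM.
have fI : 'injm f by apply/injmP => -[[? ?] ?] [[? ?] ?] _ _ /= [-> -> ->].
have fS : f @* setT = setT.
  apply/setP => -[p [c d]]; rewrite [RHS]inE; apply/morphimP.
  by exists (p, c, d); rewrite ?inE.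
rewrite /num_subgroups /subgroups -sum1_card.
rewrite (eq_bigl (fun L : {group _} => L \subset [set: _])); last by move=> L; rewrite inE.
rewrite -(sum_subgroups_injm (fun=> 1%N) fI) -[RHS]sum1_card.
by apply: eq_bigl => L; rewrite fS subsetT.
Qed.
End RankTwo.

(** * The sum over twenty indices *)

Definition index_seq (m n r s : nat) : seq (nat5 * nat5 * nat5 * nat5) :=
  let p := [seq (x, y) | x <- factorizations m n,
                         y <- factorizations (sub_gcd x) (sub_exp x)] in
  let q := [seq (w, z) | w <- p, z <- factorizations r s] in
  (* The entries of [q] are ((x, y), z), so [w.2] is z. *)
  [seq w <- [seq (w, t) | w <- q, t <- factorizations (sub_gcd w.2) (sub_exp w.2)] |
    let: (x, y, z, t) := w in
    (quo_gcd y == quo_gcd t) && (quo_exp y == quo_exp t)].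

Lemma index_seq_uniq m n r s : uniq (index_seq m n r s).
Proof.
apply: filter_uniq; do !apply: allpairs_uniq_dep => /=;
  try exact: factorizations_uniq; try by move=> ? _; exact: factorizations_uniq.
all: by move=> [? ?] [? ?] _ _ [-> ->].
Qed.

Lemma num_subgroups_sum m n r s : 0 < m -> 0 < n -> 0 < r -> 0 < s ->
  num_subgroups m n r s = \sum_(w <- index_seq m n r s) summand w.
Proof.
move=> m_gt0 n_gt0 r_gt0 s_gt0; rewrite num_subgroupsE.
have cZ u v : abelian [set: ('Zmod_u * 'Zmod_v)%type].
  by apply: abelian_setT_pair; apply: cyclic_abelian; exact: cyclic_Zmod.
have rZ u v : 'r([set: ('Zmod_u * 'Zmod_v)%type])%g <= 2.
  by apply: rank_setT_pair; exact: cyclic_Zmod.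
have cS (T : finGroupType) (U : {group T}) : abelian [set: T] -> abelian U.
  by apply: abelianS; exact: subsetT.
have rS (T : finGroupType) (U : {group T}) : 'r([set: T])%g <= 2 -> 'r(U)%g <= 2.
  by apply: leq_trans; apply: rankS; exact: subsetT.
(* The inner sum over B depends on A only through the two invariants of A, so the formula for cyclic
   pairs applies to the outer sum. *)
have sum_two_level (a b : nat) (f : nat -> nat -> nat) : 0 < a -> 0 < b ->
    \sum_(A : {group ('Zmod_a * 'Zmod_b)%type}) \sum_(B : {group _} | B \subset A)
      f (coexponent (A / B)%g) (exponent (A / B)%g) =
    \sum_(x <- factorizations a b) \sum_(y <- factorizations (sub_gcd x) (sub_exp x))
      totient (middle x) * (totient (middle y) * f (quo_gcd y) (quo_exp y)).
  move=> a_gt0 b_gt0; rewrite (eq_bigr _ (fun A _ =>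
    sum_quotients_rank2 f (cS _ A (cZ a b)) (rS _ A (rZ a b)))).
  rewrite (sum_subgroups_cyclic_pair (cyclic_Zmod a) (cyclic_Zmod b)
    (card_Zmod a_gt0) (card_Zmod b_gt0)
    (fun c e _ _ => \sum_(y <- factorizations c e)
      totient (middle y) * f (quo_gcd y) (quo_exp y))).
  by apply: eq_bigr => x _; rewrite big_distrr.
rewrite card_subgroups_pair //.
(* The sum of [g] over C and D is a function of the type (u, v) of A/B, so the two-level formula
   applies to A and B first and then to C and D. *)
pose g u v u' v' := ((u == u') && (v == v')) * num_automorphisms u v.
rewrite (sum_two_level m n (fun u v => \sum_(C : {group ('Zmod_r * 'Zmod_s)%type})
   \sum_(D : {group _} | D \subset C) g u v (coexponent (C / D)%g) (exponent (C / D)%g))) //.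
rewrite [RHS]big_filter [RHS]big_mkcond !big_allpairs_dep /=; apply: eq_bigr => x _.
apply: eq_bigr => y _; rewrite (sum_two_level r s (g _ _)) // !big_distrr; apply: eq_bigr => z _.
rewrite !big_distrr; apply: eq_bigr => t _ /=.
move: x y z t => [[[[x1 x2] x3] x4] x5] [[[[y1 y2] y3] y4] y5] [[[[z1 z2] z3] z4] z5] [[[[t1 t2] t3] t4] t5].
rewrite /g /summand /middle /quo_gcd /quo_exp /middle /=.
by case: ifP => _; rewrite ?mul0n ?muln0 // mul1n !mulnA.
Qed.

(** Positivity of the five entries comes from that of the two products. *)
Lemma factorizationsP a b x : 0 < a -> 0 < b ->
  reflect (positive5 x /\ (let: (x1, x2, x3, x4, x5) := x in
                           x1 * x2 * x3 = a /\ x3 * x4 * x5 = b))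
          (x \in factorizations a b).
Proof.
move: x => [[[[x1 x2] x3] x4] x5] a_gt0 b_gt0; rewrite mem_factorizations //.
apply: (iffP andP) => [[/eqP ea /eqP eb]|[_ [-> ->]]] //; split => //.
move: a_gt0 b_gt0; rewrite -ea -eb !muln_gt0.
by move=> /andP[/andP[? ?] ?] /andP[/andP[_ ?] ?].
Qed.

Lemma sub_type_gt0 x : positive5 x -> 0 < sub_gcd x /\ 0 < sub_exp x.
Proof.
move: x => [[[[x1 x2] x3] x4] x5] [x1_gt0 _ x3_gt0 x4_gt0 _].
by rewrite /sub_gcd /sub_exp /middle /= gcdn_gt0 muln_gt0 lcmn_gt0 x1_gt0 x3_gt0 x4_gt0.
Qed.

Lemma index_setE m n r s : 0 < m -> 0 < n -> 0 < r -> 0 < s ->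
  index_set m n r s = [set` index_seq m n r s]%classic.
Proof.
move=> m_gt0 n_gt0 r_gt0 s_gt0; apply/predeqP => -[[[x y] z] t]; split.
- move=> [[px py pz pt] E].
  have [xu xv] := sub_type_gt0 px; have [zu zv] := sub_type_gt0 pz.
  have [fx fy fz ft guv] : [/\ x \in factorizations m n,
      y \in factorizations (sub_gcd x) (sub_exp x), z \in factorizations r s,
      t \in factorizations (sub_gcd z) (sub_exp z) &
      (quo_gcd y == quo_gcd t) && (quo_exp y == quo_exp t)].
    move: x y z t px py pz pt E xu xv zu zv => [[[[? ?] ?] ?] ?] [[[[? ?] ?] ?] ?].
    move=> [[[[? ?] ?] ?] ?] [[[[? ?] ?] ?] ?] px py pz pt.
    move=> [[? ? ? ?] [[? ? ? ?] [? ?]]] xu xv zu zv.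
    split; try by apply/factorizationsP.
    by apply/andP; split; apply/eqP.
  rewrite /= mem_filter guv /=; apply/allpairsPdep.
  exists (x, y, z), t; split => //; apply/allpairsPdep.
  by exists (x, y), z; split => //; apply/allpairsPdep; exists x, y.
- rewrite /= mem_filter => /andP[/andP[/eqP eu /eqP ev]].
  move=> /allpairsPdep[w [t' [+ ft [Ew Et]]]]; subst t'.
  move=> /allpairsPdep[w' [z' [+ fz E]]]; subst w; case: E => Ew Ez; subst z'.
  move=> /allpairsPdep[x' [y' [fx fy E]]]; subst w'; case: E => Ex Ey; subst x' y'.
  have /factorizationsP[//|//|px ex] := fx; have /factorizationsP[//|//|pz ez] := fz.
  have [xu xv] := sub_type_gt0 px; have [zu zv] := sub_type_gt0 pz.
  have /factorizationsP[//|//|py ey] := fy; have /factorizationsP[//|//|pt et] := ft.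
  move: x y z t {fx fy fz ft xu xv zu zv} px py pz pt ex ey ez et eu ev.
  move=> [[[[? ?] ?] ?] ?] [[[[? ?] ?] ?] ?].
  move=> [[[[? ?] ?] ?] ?] [[[[? ?] ?] ?] ?] px py pz pt.
  by move=> [? ?] [? ?] [? ?] [? ?] ? ?; split; first by split.
Qed.

Theorem theorem3 (m n r s : nat) (m_gt0 : 0 < m) (n_gt0 : 0 < n)
    (r_gt0 : 0 < r) (s_gt0 : 0 < s) :
  num_subgroups m n r s = \big[addn/0]_(w \in index_set m n r s) summand w.
Proof.
rewrite num_subgroups_sum // index_setE //.
by rewrite -fsbig_seq // index_seq_uniq.
Qed.
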